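(* Let $k,d$ be positive integers and fix $\lambda\ge0$. Let $\vec\lambda=(\lambda_u)$ be an assignment of activities to the vertices of $\mathbb{T}_{k,d}$ with $0\le\lambda_u\le\lambda$ for every vertex $u$. Then for every $\ell\ge1$, $$\frac{R^+_\ell(\vec\lambda)}{R^-_\ell(\vec\lambda)}\le\frac{R^+_\ell}{R^-_\ell}.$$
   Context: $\mathbb{T}_{k,d}$ is the infinite $(k+1)$-uniform $(d+1)$-regular hypertree, rooted at a vertex $r$ (level 0); a vertex is at level $m$ if its distance from $r$ is $m$ (vertices adjacent iff they share a hyperedge). Thus the root lies in $d+1$ hyperedges, each containing $k$ children at level 1, and every other vertex lies in $d$ child hyperedges each containing $k$ children one level lower. For $\ell\ge1$ and activities $\vec\lambda$, define values $R_u$ for vertices at levels $\le\ell$: at level $\ell$, set $R_u=\infty$ if $\ell$ is even and $R_u=0$ if $\ell$ is odd for $R^+$, and the opposite ($0$ if $\ell$ even, $\infty$ if $\ell$ odd) for $R^-$; for $u$ at level $<\ell$ with child hyperedges $e_1,\dots,e_m$ containing children $u_{i1},\dots,u_{ik}$, set $R_u=\lambda_u\prod_{i=1}^m\frac{1}{1+\sum_{j=1}^kR_{u_{ij}}}$ (with $1/(1+\infty)=0$). $R^+_\ell(\vec\lambda)$ and $R^-_\ell(\vec\lambda)$ are the resulting values at the root under the two initializations (they are the maximum and minimum, over boundary conditions at level $\ell$, of the ratio of the probabilities that the root is occupied versus unoccupied). $R^\pm_\ell$ denotes $R^\pm_\ell(\vec\lambda)$ for the uniform assignment $\lambda_u\equiv\lambda$.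 Conventions: $0/0=1$ and $x/0=\infty$ for $x>0$. *)

(* Defs.v *)
From mathcomp Require Import all_boot all_order all_algebra.
From mathcomp Require Import reals ereal.

Set Implicit Arguments.
Unset Strict Implicit.
Unset Printing Implicit Defensive.

Import Order.TTheory GRing.Theory Num.Theory.

Local Open Scope ring_scope.

(* The vertices of the infinite (k+1)-uniform (d+1)-regular hypertree, named by
   their descent from the root.  Hyperedges below the root are numbered by
   'I_d.+1, those below any other vertex by 'I_d, and the k children in a
   hyperedge by 'I_k.  [below i j s] is reached from child j of the root in
   hyperedge i by following the (hyperedge, child) choices in s, whose head is
   the last choice made. *)
Inductive vertex (k d : nat) : Type :=
| root
| below of 'I_d.+1 & 'I_k & seq ('I_d * 'I_k).
Arguments root {k d}.

Definition level (k d : nat) (u : vertex k d) : nat :=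
  if u is below _ _ s then (size s).+1 else 0.

Definition nb_child_edges (k d : nat) (u : vertex k d) : nat :=
  if u is root then d.+1 else d.

(* The hyperedges of the tree are the sets made of a vertex u and of all the
   [child u i j], j : 'I_k, for a fixed i. *)
Definition child (k d : nat) (u : vertex k d) :
    'I_(nb_child_edges u) -> 'I_k -> vertex k d :=
  match u with
  | root => fun i j => below i j [::]
  | below i0 j0 s => fun i j => below i0 j0 ((i, j) :: s)
  end.

Lemma level_child (k d : nat) (u : vertex k d) i j :
  level (@child k d u i j) = (level u).+1.
Proof. by case: u i. Qed.

Lemma vertex_root_or_child (k d : nat) (v : vertex k d) :
  v = root \/ exists u i j, v = @child k d u i j.
Proof.
case: v => [|i j [|[i1 j1] s]]; first by left.
- by right; exists root, i, j.
- by right; exists (below i j s), i1, j1.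
Qed.

Lemma child_inj (k d : nat) (u u' : vertex k d) i j i' j' :
  @child k d u i j = @child k d u' i' j' ->
  existT (fun u : vertex k d => ('I_(nb_child_edges u) * 'I_k)%type) u (i, j) =
  existT _ u' (i', j').
Proof.
by case: u u' i i' => [|i0 j0 s] [|i0' j0' s'] i i' //= [] => [-> ->|-> -> -> -> ->].
Qed.

(* [ratio_val act b n u] is R_u for u at distance n above the boundary level,
   where R takes the value b on the whole boundary level.  The inverse is that
   of \bar R, for which (+oo)^-1 = 0. *)
Fixpoint ratio_val (R : realType) (k d : nat) (act : vertex k d -> R)
    (b : \bar R) (n : nat) (u : vertex k d) : \bar R :=
  if n is n'.+1 then
    ((act u)%:E *
     \prod_(i < nb_child_edges u)
       (1 + \sum_(j < k) ratio_val act b n' (child i j))^-1)%E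
  else b.

Definition Rplus (R : realType) (k d : nat) (act : vertex k d -> R)
    (l : nat) : \bar R :=
  ratio_val act (if odd l then 0 else +oo)%E l root.

Definition Rminus (R : realType) (k d : nat) (act : vertex k d -> R)
    (l : nat) : \bar R :=
  ratio_val act (if odd l then +oo else 0)%E l root.

(* In \bar R, 0^-1 = +oo, so that x / 0 = +oo for x > 0; but 0 / 0 = 0 there,
   whereas the convention needed here is 0 / 0 = 1. *)
Definition quot (R : realType) (x y : \bar R) : \bar R :=
  if (x == 0%E) && (y == 0%E) then 1%E else (x / y)%E.

(* Main.v *)
Require Import Defs.
From mathcomp Require Import all_boot all_order all_algebra.
From mathcomp Require Import reals ereal.
From mathcomp Require Import sequences exp ring lra.
Import Order.TTheory GRing.Theory Num.Theory.
Local Open Scope ring_scope.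

(* Write a >= b for the extreme values of R_u at a non-root vertex and A >= B
   for those of the uniform tree at the same height.  By induction on the
   height, both a / b <= A / B and (1 + k a) / (1 + k b) <= (1 + k A) / (1 + k B).
   The second bound for the children multiplies up to the first bound for the
   parent; both are linear, so they pass to the averages over a hyperedge.
   For the second bound at the parent, with p = \prod (1 + b_i) and
   P = (1 + B)^d where a_i, b_i are now sums over the i-th child hyperedge and
   k has been absorbed in A and B: if p >= P the second bound for the children
   suffices, because t |-> 1 / (1 + exp t) is decreasing; if p < P one uses the
   first bound for the children and the concavity of s |-> log (1 + c (e^s - 1))
   for c = A / B, and concludes because B (1 + A)^d <= k lambda <= A (1 + B)^d,
   which is the monotonicity in the height of the uniform values. *)

Set Implicit Arguments.
Unset Strict Implicit.
Unset Printing Implicit Defensive.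

(** * The real inequality behind one step of the recursion *)

(* Bernoulli's inequality z + c (z - 1) <= z^(1+c), multiplied over i, followed
   by 1 + c (1 - Z) <= Z^(-c). *)
Lemma prod_bernoulli (R : realType) (n : nat) (c : R) (z t : 'I_n -> R) :
  0 <= c -> (forall i, 0 < z i) ->
  (forall i, 0 <= t i <= z i + c * (z i - 1)) ->
  (\prod_i t i) * (1 + c * (1 - \prod_i z i)) <= \prod_i z i.
Proof.
move=> c_ge0 z_gt0 t_bnd.
have lnB1 (x : R) : 0 < x -> ln x <= x - 1.
  by move=> x_gt0; have := @le_ln1Dx R (x - 1); rewrite subrKC; apply; lra.
have t_le i : t i <= z i * expR (c * ln (z i)).
  have /andP[_ /le_trans->//] := t_bnd i.
  have zi := z_gt0 i.
  have -> : z i + c * (z i - 1) = z i * (1 + c * (1 - (z i)^-1)).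
    by field; rewrite gt_eqF.
  rewrite ler_pM2l//; apply: le_trans (expR_ge1Dx _) _.
  rewrite ler_expR ler_wpM2l//.
  by have := lnB1 (z i)^-1; rewrite invr_gt0 lnV// => /(_ zi); lra.
set T := \prod_i t i; set Z := \prod_i z i.
have [Z_gt0 /andP[T_ge0 T_le]] : 0 < Z /\ 0 <= T <= Z * expR (c * ln Z).
  apply: (big_rec2 (fun Z T => 0 < Z /\ 0 <= T <= Z * expR (c * ln Z))).
    by rewrite ln1 mulr0 expR0; split=> //; lra.
  move=> i Z' T' _ [Z'_gt0 /andP[T'_ge0 T'_le]].
  have /andP[ti _] := t_bnd i; have zi := z_gt0 i.
  split; first exact: mulr_gt0.
  by rewrite mulr_ge0//= lnM// mulrDr expRD mulrACA ler_pM.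
have : 1 + c * (1 - Z) <= expR (- (c * ln Z)).
  apply: le_trans (expR_ge1Dx _); rewrite lerD2l -mulrN ler_wpM2l//.
  by have := lnB1 Z Z_gt0; lra.
move=> /(ler_wpM2l T_ge0)/le_trans; apply.
apply: le_trans (ler_wpM2r (expR_ge0 _) T_le) _.
by rewrite -mulrA -expRD subrr expR0 mulr1.
Qed.

Lemma edge_prod_ratio (R : realType) (n : nat) (L A B : R) (a b : 'I_n -> R) :
  0 <= B <= A -> 0 <= L -> B * (1 + A) ^+ n <= L <= A * (1 + B) ^+ n ->
  (forall i, 0 <= b i) -> (forall i, 0 <= a i) ->
  (forall i, a i * B <= A * b i) ->
  (forall i, (1 + a i) * (1 + B) <= (1 + A) * (1 + b i)) ->
  (1 + L / \prod_i (1 + b i)) * (1 + L / (1 + A) ^+ n) <=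
  (1 + L / (1 + B) ^+ n) * (1 + L / \prod_i (1 + a i)).
Proof.
move=> /andP[B_ge0 BA] L_ge0 /andP[BL LA] b_ge0 a_ge0 rat wat.
have A_ge0 : 0 <= A by lra.
set P := (1 + B) ^+ n in LA *; set Q := (1 + A) ^+ n in BL *.
set p := \prod_i (1 + b i); set q := \prod_i (1 + a i).
have P_gt0 : 0 < P by rewrite exprn_gt0//; lra.
have Q_gt0 : 0 < Q by rewrite exprn_gt0//; lra.
have PQ : P <= Q by rewrite lerXn2r// ?nnegrE; lra.
have p_gt0 : 0 < p by rewrite prodr_gt0// => i _; have := b_ge0 i; lra.
have q_gt0 : 0 < q by rewrite prodr_gt0// => i _; have := a_ge0 i; lra.
have qPQp : q * P <= Q * p.
  have -> : P = \prod_(i < n) (1 + B) by rewrite prodr_const card_ord.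
  have -> : Q = \prod_(i < n) (1 + A) by rewrite prodr_const card_ord.
  rewrite -!big_split/=; apply: ler_prod => i _; rewrite wat andbT.
  by rewrite mulr_ge0 ?addr_ge0.
suff main : q * (P * L + P * Q - Q * p + P * p) <= (P + L) * p * Q.
  rewrite -subr_ge0.
  have -> : (1 + L / P) * (1 + L / q) - (1 + L / p) * (1 + L / Q) =
      L * ((P + L) * p * Q - q * (P * L + P * Q - Q * p + P * p))
        / (P * Q * p * q).
    by field; rewrite !gt_eqF.
  by rewrite divr_ge0 ?mulr_ge0 ?subr_ge0// ltW.
have [Pp|pP] := leP P p.
  (* For p >= P, the right side of [main] minus the left is (L + P) (Q p - q P) + q (Q - P) (p - P),
     and each term is nonnegative. *)
  have h1 : L * (q * P) <= L * (Q * p) by rewrite ler_wpM2l.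
  have h2 : 0 <= (Q * p - q * P) * P by rewrite mulr_ge0 ?subr_ge0// ltW.
  have h3 : 0 <= q * ((Q - P) * (p - P)).
    by rewrite !mulr_ge0 ?subr_ge0// ltW.
  lra.
have B_gt0 : 0 < B.
  rewrite lt_neqAle B_ge0 andbT; apply: contraTneq pP => B0.
  rewrite -leNgt /P -B0 addr0 expr1n.
  apply: (big_ind (fun x => 1 <= x)) => // [x y|i _]; first exact: mulr_ege1.
  by rewrite lerDl.
(* This c makes z + c (z - 1) equal to (1 + A b / B) / (1 + A) at z = (1 + b) / (1 + B), so the
   bound required by [prod_bernoulli] is exactly the hypothesis [rat]. *)
pose c := (A - B) / (B * (1 + A)).
have c_ge0 : 0 <= c by rewrite divr_ge0 ?mulr_ge0; lra.
have := @prod_bernoulli R n c (fun i => (1 + b i) / (1 + B))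
  (fun i => (1 + a i) / (1 + A)) c_ge0.
rewrite !prodf_div !prodr_const !card_ord -/p -/q -/P -/Q.
have z_gt0 i : 0 < (1 + b i) / (1 + B).
  by rewrite divr_gt0//; have := b_ge0 i; lra.
move=> /(_ z_gt0) H.
have {}H : q * (P + c * (P - p)) <= p * Q.
  have -> : q * (P + c * (P - p)) = q / Q * (1 + c * (1 - p / P)) * (P * Q).
    by field; rewrite !gt_eqF.
  have -> : p * Q = p / P * (P * Q) by field; rewrite gt_eqF.
  rewrite ler_pM2r ?mulr_gt0//; apply: H => i.
  rewrite divr_ge0 ?addr_ge0//=.
  have -> : (1 + b i) / (1 + B) + c * ((1 + b i) / (1 + B) - 1) =
      (1 + A * b i / B) / (1 + A).
    by rewrite /c; field; rewrite !gt_eqF//; lra.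
  by rewrite ler_pM2r ?invr_gt0 ?ltr_wpDr// lerD2l ler_pdivlMr.
(* Both bounds on L enter here, also combined as B Q <= A P. *)
have hc : Q - P <= c * (P + L).
  rewrite /c mulrAC ler_pdivlMr ?mulr_gt0//; last lra.
  have h1 : A * (B * Q) <= A * L by rewrite ler_wpM2l.
  have h2 : B * L <= B * (A * P) by rewrite ler_wpM2l.
  lra.
(* The left side of [main] is q (P (P + L) + (P - p) (Q - P)); bounding Q - P by [hc] turns it into
   (P + L) times the left side of [H]. *)
have h1 : (P + L) * (q * (P + c * (P - p))) <= (P + L) * (p * Q).
  by rewrite ler_wpM2l//; lra.
have h2 : q * (P - p) * (Q - P) <= q * (P - p) * (c * (P + L)).
  by rewrite ler_wpM2l// mulr_ge0 ?subr_ge0// ltW.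
lra.
Qed.

(** * Finite values of the recursion *)

(* The real value of R_u for u at distance n.+1 above the boundary level; top
   tells which of the two extremes is taken, and the shift by one avoids the
   infinite boundary values. *)
Fixpoint ratio (R : realType) (k d : nat) (act : vertex k d -> R)
    (top : bool) (n : nat) (u : vertex k d) : R :=
  if n is n'.+1 then
    act u * \prod_(i < nb_child_edges u)
      (1 + \sum_(j < k) ratio act (~~ top) n' (child i j))^-1
  else if top then act u else 0.

(** The uniform value away from the root, where it depends on the height only; the root has one more
    child hyperedge and is treated separately. *)
Fixpoint uratio (R : realType) (k d : nat) (lambda : R) (top : bool)
    (n : nat) : R :=
  if n is n'.+1 then lambda / (1 + k%:R * uratio k d lambda (~~ top) n') ^+ d
  else if top then lambda else 0.

Lemma ratio_ge0 (R : realType) (k d : nat) (act : vertex k d -> R) top n u :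
  (forall u, 0 <= act u) -> 0 <= ratio act top n u.
Proof.
move=> act_ge0; elim: n top u => [|n IH] top u /=; first by case: top.
by rewrite mulr_ge0// prodr_ge0// => i _; rewrite invr_ge0 addr_ge0// sumr_ge0.
Qed.

(** Each level exchanges maximum and minimum, so the boundary value that yields the extreme [top] is
    fixed by the parity of the height. *)
Lemma ratio_valE (R : realType) (k d : nat) (act : vertex k d -> R) top n u :
  (0 < k)%N -> (0 < d)%N -> (forall u, 0 <= act u) ->
  ratio_val act (if odd n.+1 == top then 0 else +oo)%E n.+1 u =
  (ratio act top n u)%:E.
Proof.
move=> k_gt0 d_gt0 act_ge0; elim: n top u => [|n IH] top u.
  rewrite /=; case: top => /=.
    rewrite big1 ?mule1// => i _.
    by rewrite big1// adde0 inver oner_eq0 invr1.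
  have nb_gt0 : (0 < nb_child_edges u)%N by case: u.
  (* A single infinite child already makes the product vanish; positivity of k and d provides
     one. *)
  rewrite (bigD1 (Ordinal nb_gt0))//= (bigD1 (Ordinal k_gt0))//=.
  rewrite addye ?addey// ?invey ?mul0e ?mule0//.
  by rewrite -ltNye (lt_le_trans ltNy0)// sume_ge0.
have -> : (odd n.+2 == top) = (odd n.+1 == ~~ top) by case: top => /=; case: (odd n).
have -> b : ratio_val act b n.+2 u = ((act u)%:E *
    \prod_(i < nb_child_edges u)
      (1 + \sum_(j < k) ratio_val act b n.+1 (child i j))^-1)%E by [].
rewrite [ratio _ _ _ _]/= EFinM -prodEFin; congr (_ * _)%E.
apply: eq_bigr => i _.
rewrite (eq_bigr _ (fun j _ => IH (~~ top) (child i j))).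
rewrite sumEFin -EFinD inver gt_eqF// ltr_pwDl// sumr_ge0// => j _.
exact: ratio_ge0.
Qed.

(** * The induction invariant and its propagation *)

(** Both comparisons of ratios are cross-multiplied, so that vanishing minima are allowed. *)
Definition dominated (R : realType) (k : nat) (a b A B : R) :=
  [/\ 0 <= b <= a, a * B <= A * b &
      (1 + k%:R * a) * (1 + k%:R * B) <= (1 + k%:R * A) * (1 + k%:R * b)].

Lemma dominated_edge (R : realType) (k : nat) (a b : 'I_k -> R) (A B : R) :
  (0 < k)%N -> (forall j, dominated k (a j) (b j) A B) ->
  [/\ 0 <= \sum_j b j <= \sum_j a j,
      (\sum_j a j) * (k%:R * B) <= k%:R * A * \sum_j b j &
      (1 + \sum_j a j) * (1 + k%:R * B) <=
      (1 + k%:R * A) * (1 + \sum_j b j)].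
Proof.
move=> k_gt0 ab; split.
- rewrite sumr_ge0 => [|j _]; last by case: (ab j) => /andP[].
  by rewrite ler_sum// => j _; case: (ab j) => /andP[].
- rewrite mulrCA -mulrA ler_wpM2l// mulr_suml mulr_sumr ler_sum// => j _.
  by case: (ab j).
- have k0 : 0 < k%:R :> R by rewrite ltr0n.
  (* 1 + \sum_j x j is the average of the 1 + k x j, to which the third clause of [dominated]
     applies termwise. *)
  have avg (x : 'I_k -> R) : k%:R * (1 + \sum_j x j) = \sum_j (1 + k%:R * x j).
    by rewrite big_split/= sumr_const card_ord -mulr_sumr mulrDr mulr1.
  rewrite -(ler_pM2l k0) mulrA avg mulrCA avg mulr_suml mulr_sumr.
  by rewrite ler_sum// => j _; case: (ab j).
Qed.

(** The map x |-> lambda / (1 + k x)^d is antitone and exchanges the two extremes, so the intervals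
    between them, starting from [0, lambda], are nested. *)
Lemma uratio_mono (R : realType) (k d : nat) (lambda : R) n :
  0 <= lambda ->
  [/\ 0 <= uratio k d lambda false n <= uratio k d lambda true n,
      uratio k d lambda false n <= uratio k d lambda false n.+1 &
      uratio k d lambda true n.+1 <= uratio k d lambda true n].
Proof.
move=> l_ge0.
have f_ge0 x : 0 <= x -> 0 <= lambda / (1 + k%:R * x) ^+ d.
  by move=> x_ge0; rewrite divr_ge0// exprn_ge0// addr_ge0// mulr_ge0.
have f_anti x y : 0 <= x -> x <= y ->
    lambda / (1 + k%:R * y) ^+ d <= lambda / (1 + k%:R * x) ^+ d.
  move=> x_ge0 xy; have y_ge0 := le_trans x_ge0 xy.
  have gt0 z : 0 <= z -> 0 < 1 + k%:R * z by move=> ?; rewrite ltr_pwDl// mulr_ge0.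
  rewrite ler_wpM2l// lef_pV2 ?posrE ?exprn_gt0 ?gt0//.
  by rewrite lerXn2r ?nnegrE ?addr_ge0 ?mulr_ge0// lerD2l ler_wpM2l.
elim: n => [|n [/andP[F_ge0 FT] FF TT]].
  by rewrite /= mulr0 addr0 expr1n divr1 !lexx l_ge0 f_ge0.
have T_ge0 := le_trans F_ge0 FT.
split; [apply/andP; split| |].
- exact: f_ge0.
- exact: f_anti.
- by apply: f_anti TT; apply: f_ge0.
- exact: f_anti.
Qed.

(** At height n.+1, lambda equals one extreme times (1 + k y)^d with y the opposite extreme at
    height n; replacing y by its value at n.+1 costs an inequality given by [uratio_mono]. *)
Lemma uratio_bounds (R : realType) (k d : nat) (lambda : R) n :
  0 <= lambda ->
  uratio k d lambda false n * (1 + k%:R * uratio k d lambda true n) ^+ d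
    <= lambda <=
  uratio k d lambda true n * (1 + k%:R * uratio k d lambda false n) ^+ d.
Proof.
move=> l_ge0; case: n => [|n].
  by rewrite /= mul0r mulr0 addr0 expr1n mulr1 l_ge0 lexx.
have [/andP[F_ge0 FT] FF TT] := @uratio_mono R k d lambda n l_ge0.
have [/andP[F1_ge0 FT1] _ _] := @uratio_mono R k d lambda n.+1 l_ge0.
have le x y : 0 <= x -> x <= y -> (1 + k%:R * x) ^+ d <= (1 + k%:R * y) ^+ d.
  move=> x_ge0 xy; have y_ge0 := le_trans x_ge0 xy.
  by rewrite lerXn2r ?nnegrE ?addr_ge0 ?mulr_ge0// lerD2l ler_wpM2l.
have gt0 x : 0 <= x -> 0 < (1 + k%:R * x) ^+ d.
  by move=> x_ge0; rewrite exprn_gt0// ltr_pwDl// mulr_ge0.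
rewrite {1}[uratio _ _ _ false n.+1]/= {2}[uratio _ _ _ true n.+1]/=
  ![_ / _ * _]mulrAC.
have T_ge0 := le_trans F_ge0 FT.
rewrite ler_pdivrMr ?gt0// ler_pdivlMr ?gt0//.
by rewrite !ler_wpM2l// le// (le_trans F1_ge0).
Qed.

(** The ratio bound is separated from [dominated_prod] to serve at the root as well, where m is d.+1
    whereas [uratio_bounds] has exponent d. *)
Lemma dominated_prod_ratio (R : realType) (k m : nat) (x l A B : R)
    (a b : 'I_m -> 'I_k -> R) :
  (0 < k)%N -> 0 <= x -> 0 <= l -> 0 <= B <= A ->
  (forall i j, dominated k (a i j) (b i j) A B) ->
  let a' := x * \prod_i (1 + \sum_j b i j)^-1 in
  let b' := x * \prod_i (1 + \sum_j a i j)^-1 in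
  0 <= b' <= a' /\
  a' * (l / (1 + k%:R * A) ^+ m) <= l / (1 + k%:R * B) ^+ m * b'.
Proof.
move=> k_gt0 x_ge0 l_ge0 /andP[B_ge0 BA] ab a' b'.
have A_ge0 := le_trans B_ge0 BA.
have gt0 (z : R) : 0 <= z -> 0 < 1 + z by move=> ?; rewrite ltr_pwDl.
have E i := @dominated_edge R k (a i) (b i) A B k_gt0 (ab i).
have b_ge0 i : 0 <= \sum_j b i j by have [/andP[]] := E i.
have a_ge0 i : 0 <= \sum_j a i j.
  by have [/andP[_ /(le_trans _)->]] := E i.
split.
  rewrite mulr_ge0/= ?prodr_ge0// => [|i _]; last by rewrite invr_ge0 ltW ?gt0.
  rewrite ler_wpM2l// ler_prod// => i _.
  rewrite invr_ge0 ltW ?gt0//= lef_pV2 ?posrE ?gt0// lerD2l.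
  by have [/andP[]] := E i.
rewrite /a' /b' -!exprVn mulrACA [leRHS]mulrACA [l * x]mulrC.
rewrite ler_wpM2l ?mulr_ge0//.
have const (c : R) : c ^+ m = \prod_(i < m) c by rewrite prodr_const card_ord.
rewrite !const -!big_split ler_prod//= => i _.
have kA := gt0 _ (mulr_ge0 (ler0n R k) A_ge0).
have kB := gt0 _ (mulr_ge0 (ler0n R k) B_ge0).
have [ea eb] := (gt0 _ (a_ge0 i), gt0 _ (b_ge0 i)).
rewrite -!invfM; apply/andP; split; first by rewrite invr_ge0 mulr_ge0// ltW.
rewrite lef_pV2 ?posrE ?mulr_gt0//.
by rewrite mulrC [leRHS]mulrC; have [] := E i.
Qed.

(** For activity l the third clause is [edge_prod_ratio] with L = k l; lowering the activity to x
    only decreases (1 + k x u) / (1 + k x v), since v <= u. *)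
Lemma dominated_prod (R : realType) (k m : nat) (x l A B : R)
    (a b : 'I_m -> 'I_k -> R) :
  (0 < k)%N -> 0 <= x <= l -> 0 <= B <= A ->
  B * (1 + k%:R * A) ^+ m <= l <= A * (1 + k%:R * B) ^+ m ->
  (forall i j, dominated k (a i j) (b i j) A B) ->
  dominated k (x * \prod_i (1 + \sum_j b i j)^-1)
    (x * \prod_i (1 + \sum_j a i j)^-1)
    (l / (1 + k%:R * B) ^+ m) (l / (1 + k%:R * A) ^+ m).
Proof.
move=> k_gt0 /andP[x_ge0 xl] BA lAB ab; have l_ge0 := le_trans x_ge0 xl.
have [ba rat] := @dominated_prod_ratio R k m x l A B a b k_gt0 x_ge0 l_ge0 BA ab.
split=> //.
have /andP[B_ge0 leBA] := BA.
have k_ge0 : 0 <= k%:R :> R by [].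
have E i := @dominated_edge R k (a i) (b i) A B k_gt0 (ab i).
have b_ge0 i : 0 <= \sum_j b i j by have [/andP[]] := E i.
have a_ge0 i : 0 <= \sum_j a i j.
  by have [/andP[_ /(le_trans _)->]] := E i.
have [p_gt0 q_gt0] : 0 < \prod_i (1 + \sum_j b i j) /\
    0 < \prod_i (1 + \sum_j a i j).
  by split; rewrite prodr_gt0// => i _; rewrite ltr_pwDl.
have vu : (\prod_i (1 + \sum_j a i j))^-1 <= (\prod_i (1 + \sum_j b i j))^-1.
  rewrite lef_pV2 ?posrE// ler_prod// => i _.
  by rewrite addr_ge0//= lerD2l; have [/andP[]] := E i.
have H : (1 + k%:R * l * (\prod_i (1 + \sum_j b i j))^-1) *
      (1 + k%:R * l * ((1 + k%:R * A) ^+ m)^-1) <=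
    (1 + k%:R * l * ((1 + k%:R * B) ^+ m)^-1) *
      (1 + k%:R * l * (\prod_i (1 + \sum_j a i j))^-1).
  apply: edge_prod_ratio => //.
  - by rewrite mulr_ge0//= ler_wpM2l.
  - by rewrite mulr_ge0.
  - by case/andP: lAB => ? ?; rewrite -!mulrA !ler_wpM2l.
  - by move=> i; have [] := E i.
  - by move=> i; have [] := E i.
move: H vu; rewrite !prodfV; move: q_gt0; rewrite -invr_gt0.
set v := (\prod_i (1 + \sum_j a i j))^-1.
set u := (\prod_i (1 + \sum_j b i j))^-1.
set V := (_ ^+ m)^-1; set U := (_ ^+ m)^-1 => v_gt0 H vu.
have kl_ge0 : 0 <= k%:R * l by rewrite mulr_ge0.
have kx_ge0 : 0 <= k%:R * x by rewrite mulr_ge0.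
have V_ge0 : 0 <= V.
  by rewrite invr_ge0 exprn_ge0// addr_ge0// mulr_ge0// (le_trans B_ge0).
have lv_gt0 : 0 < 1 + k%:R * l * v by rewrite ltr_pwDl// mulr_ge0// ltW.
(* The extra factor 1 + k l v lets [le1], the change of activity, be chained with [H]. *)
rewrite !mulrA -(ler_pM2r lv_gt0) [leLHS]mulrAC.
have le1 : (1 + k%:R * x * u) * (1 + k%:R * l * v) <=
    (1 + k%:R * l * u) * (1 + k%:R * x * v).
  rewrite -subr_ge0.
  have -> : (1 + k%:R * l * u) * (1 + k%:R * x * v) -
    (1 + k%:R * x * u) * (1 + k%:R * l * v) = k%:R * (l - x) * (u - v) by ring.
  by rewrite !mulr_ge0 ?subr_ge0.
apply: (@le_trans _ _ ((1 + k%:R * l * u) * (1 + k%:R * x * v) *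
    (1 + k%:R * l * V))).
  by rewrite ler_wpM2r// addr_ge0// mulr_ge0.
rewrite [leLHS]mulrAC [leRHS]mulrAC ler_wpM2r//.
by rewrite addr_ge0// mulr_ge0// ltW.
Qed.

(** * Quotients at the root *)

(** If A = B = 0 the right side is 1 by convention, and the last hypothesis makes the left side 0/0
    too. If B = 0 < A the right side is infinite. If B > 0, then b = 0 forces a = 0, and 1 <= A /
    B. *)
Lemma quot_le (R : realType) (a b A B : R) :
  0 <= b <= a -> 0 <= B <= A -> a * B <= A * b -> (A = 0 -> a = 0) ->
  (quot a%:E b%:E <= quot A%:E B%:E)%E.
Proof.
move=> /andP[b_ge0 ba] /andP[B_ge0 BA] aBAb A0.
have [B0|B_neq0] := eqVneq B 0.
  have [A_eq0|A_neq0] := eqVneq A 0.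
    have a0 := A0 A_eq0; have b0 : b = 0 by lra.
    by rewrite a0 b0 A_eq0 B0.
  rewrite [leRHS]/quot !eqe (negbTE A_neq0)/= B0 inve0 gt0_muley ?leey//.
  by rewrite lte_fin lt_neqAle eq_sym A_neq0 (le_trans B_ge0).
have B_gt0 : 0 < B by rewrite lt_neqAle eq_sym B_neq0.
rewrite [leRHS]/quot !eqe (negbTE B_neq0) andbF inver (negbTE B_neq0) -EFinM.
rewrite /quot !eqe; case: ifPn => [_|].
  by rewrite lee_fin ler_pdivlMr// mul1r.
have [b0|b_neq0 _] := eqVneq b 0; rewrite ?andbT.
  move=> a_neq0; have : a * B <= 0 by rewrite (le_trans aBAb)// b0 mulr0.
  by rewrite pmulr_lle0// => a_le0; case/eqP: a_neq0; lra.
have b_gt0 : 0 < b by rewrite lt_neqAle eq_sym b_neq0.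
rewrite inver (negbTE b_neq0) -EFinM lee_fin ler_pdivrMr// mulrAC.
by rewrite ler_pdivlMr.
Qed.

Lemma uratioE (R : realType) (k d : nat) (lambda : R) top n i j s :
  ratio (fun _ : vertex k d => lambda) top n (below i j s) =
  uratio k d lambda top n.
Proof.
elim: n top i j s => //= n IH top i j s.
congr (_ * _); under eq_bigr do under eq_bigr do rewrite IH.
by rewrite prodfV prodr_const sumr_const !card_ord mulr_natl.
Qed.

Lemma ratio_dominated (R : realType) (k d : nat) (lambda : R)
    (act : vertex k d -> R) n i j s :
  (0 < k)%N -> (forall u, 0 <= act u <= lambda) ->
  dominated k (ratio act true n (below i j s)) (ratio act false n (below i j s))
    (uratio k d lambda true n) (uratio k d lambda false n).
Proof.
move=> k_gt0 act_bnd.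
have l_ge0 : 0 <= lambda by have /andP[/le_trans] := act_bnd Defs.root; apply.
elim: n i j s => [|n IH] i j s /=.
  have /andP[u_ge0 ul] := act_bnd (below i j s).
  rewrite /dominated !mulr0 lexx u_ge0 !addr0 !mulr1; split=> //.
  by rewrite lerD2l ler_wpM2l.
have [FT _ _] := @uratio_mono R k d lambda n l_ge0.
exact: dominated_prod k_gt0 (act_bnd _) FT (uratio_bounds _ _ _ l_ge0) _.
Qed.

(* MathComp-Analysis: R is an arbitrary realType *)
Theorem theorem17 (R : realType) (k d : nat) (lambda : R)
    (act : vertex k d -> R) (l : nat)
    (k_gt0 : (0 < k)%N) (d_gt0 : (0 < d)%N) (lambda_ge0 : 0 <= lambda)
    (act_bound : forall u : vertex k d, 0 <= act u <= lambda)
    (l_ge1 : (1 <= l)%N) :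
  (quot (Rplus act l) (Rminus act l) <=
   quot (Rplus (fun _ : vertex k d => lambda) l)
        (Rminus (fun _ : vertex k d => lambda) l))%E.
Proof.
have valE (act' : vertex k d -> R) : (forall u, 0 <= act' u) ->
    Rplus act' l = (ratio act' true l.-1 Defs.root)%:E /\
    Rminus act' l = (ratio act' false l.-1 Defs.root)%:E.
  move=> act'_ge0; rewrite -!ratio_valE// prednK// /Rplus /Rminus.
  by split; case: (odd l).
have act_ge0 u : 0 <= act u by case/andP: (act_bound u).
have [-> ->] := valE _ act_ge0.
have [-> ->] := valE (fun=> lambda) (fun=> lambda_ge0).
have /andP[r_ge0 rl] := act_bound Defs.root.
case: l.-1 => [|n] /=.
  apply: quot_le; rewrite ?lexx ?r_ge0 ?lambda_ge0 ?mulr0 ?mul0r//.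
  by move=> l0; apply/eqP; rewrite eq_le r_ge0 -l0 rl.
have [FT _ _] := @uratio_mono R k d lambda n lambda_ge0.
have dom i j := @ratio_dominated R k d lambda act n i j [::] k_gt0 act_bound.
(* The uniform assignment is itself admissible; this orders its two extremes at the root. *)
have unif i j : dominated k
    (ratio (fun _ : vertex k d => lambda) true n (below i j [::]))
    (ratio (fun _ : vertex k d => lambda) false n (below i j [::]))
    (uratio k d lambda true n) (uratio k d lambda false n).
  by apply: ratio_dominated => // u; rewrite lambda_ge0 lexx.
have prodE top : \prod_(i < d.+1)
    (1 + \sum_(j < k) ratio (fun=> lambda) top n (below i j [::]))^-1 =
    ((1 + k%:R * uratio k d lambda top n) ^+ d.+1)^-1.
  under eq_bigr do under eq_bigr do rewrite uratioE.
  by rewrite prodfV prodr_const sumr_const !card_ord mulr_natl.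
have [ba rat] := dominated_prod_ratio k_gt0 r_ge0 lambda_ge0 FT dom.
have [BA _] := dominated_prod_ratio k_gt0 lambda_ge0 lambda_ge0 FT unif.
apply: quot_le => //.
  by rewrite !prodE.
(* The product is positive, so the uniform maximum vanishes only if lambda = 0, and then the
   activity of the root is 0 as well. *)
move=> /eqP; rewrite mulf_eq0 => /orP[/eqP l0|].
  have -> : act Defs.root = 0 by apply/eqP; rewrite eq_le r_ge0 -l0 rl.
  by rewrite mul0r.
rewrite gt_eqF// prodr_gt0// => i _; rewrite invr_gt0 ltr_pwDl// sumr_ge0// => j _.
exact: ratio_ge0.
Qed.
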